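(* Let $G$ be a finite simple graph and $\theta$ a real number. Suppose $N_{\theta}(G)=\varnothing$, i.e. $G$ has no $\theta$-neutral vertices. Then $A_{\theta}(G)$, the set of all $\theta$-special vertices of $G$, is the intersection of all (inclusionwise) maximal $\theta$-barrier sets in $G$.
   Context: All graphs are finite and simple. An $r$-matching in a graph $G$ is a set of $r$ edges, no two of which share a vertex; $p(G,r)$ is the number of $r$-matchings in $G$, with $p(G,0)=1$. For $G$ with $n$ vertices the matching polynomial is $\mu(G,x)=\sum_{r=0}^{\lfloor n/2\rfloor}(-1)^r p(G,r)x^{n-2r}$ (so it equals $1$ for the graph with no vertices). For a real number $\theta$, $\mathrm{mult}(\theta,G)$ is the multiplicity of $\theta$ as a root of $\mu(G,x)$ ($0$ if $\theta$ is not a root). $G\setminus X$ is the graph obtained from $G$ by deleting the vertices in $X$ and all incident edges; $G\setminus u=G\setminus\{u\}$. For every vertex $u$, $\mathrm{mult}(\theta,G\setminus u)$ differs from $\mathrm{mult}(\theta,G)$ by at most $1$. A vertex $u$ is $\theta$-essential if $\mathrm{mult}(\theta,G\setminus u)=\mathrm{mult}(\theta,G)-1$, $\theta$-neutral if $\mathrm{mult}(\theta,G\setminus u)=\mathrm{mult}(\theta,G)$, and $\theta$-positive if $\mathrm{mult}(\theta,G\setminus u)=\mathrm{mult}(\theta,G)+1$. A vertex is $\theta$-special if it is not $\theta$-essential but is adjacent to some $\theta$-essential vertex. $A_\theta(G)$ is the set of $\theta$-special vertices of $G$ and $N_\theta(G)$ the set of $\theta$-neutral vertices of $G$. A graph is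 $\theta$-critical if all its vertices are $\theta$-essential and the multiplicity of $\theta$ as a root of its matching polynomial is $1$. ''Component'' means connected component, and $c_\theta(G)$ is the number of $\theta$-critical components of $G$. A $\theta$-barrier set in $G$ is a set $X\subseteq V(G)$ with $\mathrm{mult}(\theta,G)=c_\theta(G\setminus X)-|X|$; it is maximal if it is not properly contained in another $\theta$-barrier set of $G$. *)

(* Defs.v *)
From mathcomp Require Import all_boot all_order all_algebra.
From mathcomp Require Import reals.

Set Implicit Arguments.
Unset Strict Implicit.
Unset Printing Implicit Defensive.

Import Order.TTheory GRing.Theory Num.Theory.

Local Open Scope ring_scope.

(* A simple graph is a symmetric irreflexive relation e on a finite type T.
   Every notion below takes a set S : {set T} and refers to the subgraph of
   (T, e) induced by S, so that the whole graph is S = [set: T] and deleting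
   X from the graph on S gives the graph on S :\: X.  Symmetry and
   irreflexivity of e are hypotheses of the theorems, not of the definitions. *)

Definition edges (T : finType) (e : rel T) (S : {set T}) : {set {set T}} :=
  [set [set x; y] | x in S, y in S & e x y].

Definition matchings (T : finType) (e : rel T) (S : {set T}) (r : nat) :
    {set {set {set T}}} :=
  [set M : {set {set T}} | [&& M \subset edges e S, #|M| == r & trivIset M]].

Definition matching_poly (R : nzRingType) (T : finType) (e : rel T)
    (S : {set T}) : {poly R} :=
  \sum_(r < (#|S|./2).+1)
    ((-1) ^+ r * #|matchings e S r|%:R) *: 'X^(#|S| - r.*2).

Definition mult (R : realType) (theta : R) (T : finType) (e : rel T)
    (S : {set T}) : nat :=
  mup theta (matching_poly R e S).

Definition essential (R : realType) (theta : R) (T : finType) (e : rel T)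
    (S : {set T}) (u : T) : bool :=
  (u \in S) && ((mult theta e (S :\ u)).+1 == mult theta e S).

Definition neutral (R : realType) (theta : R) (T : finType) (e : rel T)
    (S : {set T}) (u : T) : bool :=
  (u \in S) && (mult theta e (S :\ u) == mult theta e S).

Definition special (R : realType) (theta : R) (T : finType) (e : rel T)
    (S : {set T}) (u : T) : bool :=
  [&& u \in S, ~~ essential theta e S u
    & [exists v in S, e u v && essential theta e S v]].

Definition special_set (R : realType) (theta : R) (T : finType) (e : rel T)
    (S : {set T}) : {set T} := [set u | special theta e S u].

Definition neutral_set (R : realType) (theta : R) (T : finType) (e : rel T)
    (S : {set T}) : {set T} := [set u | neutral theta e S u].

Definition critical (R : realType) (theta : R) (T : finType) (e : rel T)
    (S : {set T}) : bool :=
  [forall u in S, essential theta e S u] && (mult theta e S == 1%N).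

Definition components (T : finType) (e : rel T) (S : {set T}) :
    {set {set T}} :=
  equivalence_partition
    (connect [rel x y | [&& x \in S, y \in S & e x y]]) S.

Definition nb_critical (R : realType) (theta : R) (T : finType) (e : rel T)
    (S : {set T}) : nat :=
  #|[set C in components e S | critical theta e C]|.

(* The difference is taken in int: truncated subtraction on nat would wrongly
   accept sets X with more elements than G \ X has critical components. *)
Definition barrier (R : realType) (theta : R) (T : finType) (e : rel T)
    (S X : {set T}) : bool :=
  (X \subset S) &&
  ((mult theta e S)%:Z == (nb_critical theta e (S :\: X))%:Z - #|X|%:Z).

(* Main.v *)
Require Import Defs.
From mathcomp Require Import all_boot all_order all_algebra.
From mathcomp Require Import reals.
From mathcomp Require Import ring zify.

(** Write m(S) for the multiplicity of theta in the matching polynomial mu(S)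
of the graph induced on S.  A barrier X satisfies m(S \ X) = m(S) + |X|, hence
every B contained in X satisfies m(S \ B) = m(S) + |B| (interlacing, one vertex
at a time), and every component of S \ X is critical or has multiplicity 0.

The special set A lies in every barrier X ([special_sub_barrier]).  If a is
special and x is positive, then a stays special after the deletion of x; so a
special vertex outside X would be special in S \ X, and it would lie, together
with an essential neighbour, in one component of S \ X.  That component has
positive multiplicity, so it is critical, so a is essential: a contradiction.

Conversely let v be outside A.  If v is essential, no barrier contains it, and
A itself is a barrier ([special_barrier]) which extends to a maximal one.  If v
is not essential it is positive, since no vertex is neutral, and the vertex
recurrence at v gives a neighbour w with m(S \ v \ w) <= m(S).  This w is not
essential, as v is not special; so w is positive, and w together with the
special set of S \ w is a barrier ([barrierU1]).  A maximal barrier above it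
contains w and therefore not v, as m(S \ {v, w}) would be m(S) + 2.

That A is a barrier is the Gallai-Edmonds structure theorem for theta.  It
rests on three facts: special vertices are positive ([special_positive]),
deleting a special vertex does not change which other vertices are essential
([special_essential]), and a connected graph all of whose vertices are essential
has multiplicity 1 ([gallai]).  All three are derived from the vertex recurrence
  mu(S) = X mu(S \ u) - sum over neighbours w of u of mu(S \ u \ w)
through the Heilmann-Lieb identity: the Wronskian
  W(u, v) = mu(S \ u) mu(S \ v) - mu(S) mu(S \ u \ v)
is a sum of squares of polynomials ([wronskian_sos]), so theta is a root of it of even
multiplicity ([mult_parity]).  The identity only uses the recurrence, with
arbitrary vertex weights.  Changing the weight of a third vertex d from X to
X + 1 replaces mu(S) by mu(S) + mu(S \ d); the Wronskian becomes the sum of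
those of S and of S \ d and of a cross term, and it still has even multiplicity.
This constraint on triples of vertices ([mult_triple]) is what gives both
stability and Gallai's lemma. *)

Set Implicit Arguments.
Unset Strict Implicit.
Unset Printing Implicit Defensive.

Import Order.TTheory GRing.Theory Num.Theory.

Local Open Scope ring_scope.

(** * The vertex recurrence of the matching polynomial *)

Lemma setD1AC (T : finType) (S : {set T}) (u v : T) :
  S :\ u :\ v = S :\ v :\ u.
Proof. by rewrite !setDDl setUC. Qed.

Section Recurrence.
Variables (T : finType) (e : rel T).
Hypotheses (e_sym : symmetric e) (e_irr : irreflexive e).
Implicit Types (S B : {set T}) (M : {set {set T}}) (u v w : T).

Definition is_matching S M := (M \subset edges e S) && trivIset M.

Lemma edgesP S B :
  reflect (exists x y, [/\ x \in S, y \in S, e x y & B = [set x; y]])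
          (B \in edges e S).
Proof.
apply: (iffP imset2P) => [[x y xS] | [x [y [xS yS exy ->]]]].
  by rewrite inE => /andP[yS exy] ->; exists x, y.
by exists x y => //; rewrite inE yS.
Qed.

Lemma edges_sub S B : B \in edges e S -> B \subset S.
Proof. by case/edgesP=> x [y [xS yS _ ->]]; rewrite subUset !sub1set xS. Qed.

Lemma card_edge S B : B \in edges e S -> #|B| = 2%N.
Proof.
case/edgesP=> x [y [_ _ exy ->]]; rewrite cards2.
by case: eqVneq exy => // ->; rewrite e_irr.
Qed.

Lemma edges_set2 S u w : u \in S -> ([set u; w] \in edges e S) = (w \in S) && e u w.
Proof.
move=> uS; apply/idP/andP => [/edgesP[x [y [xS yS exy eB]]]|[wS euw]]; last first.
  by apply/edgesP; exists u, w.
have nxy : x != y by case: eqVneq exy => // ->; rewrite e_irr.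
have: u \in [set x; y] by rewrite -eB set21.
have: w \in [set x; y] by rewrite -eB set22.
have: y \in [set u; w] by rewrite eB set22.
have: x \in [set u; w] by rewrite eB set21.
rewrite !inE.
do 2![case/orP=> /eqP ?; subst]; rewrite ?eqxx //= in nxy *.
by rewrite e_sym.
Qed.

Lemma edgesD1 S u B : (B \in edges e (S :\ u)) = (B \in edges e S) && (u \notin B).
Proof.
apply/edgesP/andP => [[x [y []]]|[/edgesP[x [y [xS yS exy ->]]]]].
  rewrite !inE => /andP[xu xS] /andP[yu yS] exy ->; split.
    by apply/edgesP; exists x, y.
  by rewrite !inE negb_or eq_sym xu eq_sym yu.
rewrite !inE negb_or => /andP[ux uy]; exists x, y.
by rewrite !inE eq_sym ux eq_sym uy xS yS.
Qed.

Lemma is_matchingD1 S u M :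
  is_matching (S :\ u) M = is_matching S M && (u \notin cover M).
Proof.
rewrite /is_matching andbAC; congr (_ && _).
apply/subsetP/andP => [sM | [/subsetP sM uM] B BM].
  split; first by apply/subsetP=> B /sM; rewrite edgesD1 => /andP[].
  by apply/bigcupP=> -[B /sM]; rewrite edgesD1 => /andP[_ /negP].
rewrite edgesD1 sM //; apply: contra uM => uB.
by apply/bigcupP; exists B.
Qed.

Lemma card_matching S M : is_matching S M -> (#|M|.*2 <= #|S|)%N.
Proof.
case/andP=> /subsetP sM /eqP tM.
have -> : #|M|.*2 = #|cover M|.
  rewrite -tM (eq_bigr (fun _ => 2%N)) => [|B /sM/card_edge //].
  by rewrite sum_nat_const muln2.
apply: subset_leq_card; apply/bigcupsP => B /sM; exact: edges_sub.
Qed.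

Lemma is_matchingU1 S u w M : u \in S -> w \in S -> e u w ->
  is_matching S ([set u; w] |: M) && ([set u; w] \notin M)
  = is_matching (S :\ u :\ w) M.
Proof.
move=> uS wS euw; rewrite !is_matchingD1; set B := [set u; w].
apply/andP/andP => [[/andP[sM tM] BM]|[/andP[/andP[sM tM] uM wM]]].
  have MD A : A \in M -> [disjoint B & A].
    move=> AM; move/trivIsetP: tM; apply; rewrite ?setU11 ?setU1r //.
    by apply: contraNneq BM => ->.
  have nM x : x \in B -> x \notin cover M.
    move=> xB; apply/bigcupP => -[A AM xA].
    by have := disjointFr (MD A AM) xB; rewrite xA.
  rewrite !nM ?set21 ?set22 // andbT; split=> //; apply/andP; split.
    by apply: subset_trans sM; apply: subsetUr.
  by apply: trivIsetS tM; apply: subsetUr.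
have nB A : A \in M -> [disjoint B & A].
  move=> AM; rewrite disjoints_subset subUset !sub1set !inE.
  apply/andP; split; [move: uM|move: wM]; apply: contra => xA;
  by apply/bigcupP; exists A.
have [] := trivIsetU1 nB tM.
  apply/negP => /(subsetP sM) /card_edge; by rewrite cards0.
move=> tBM BM; rewrite BM /is_matching tBM andbT subUset sM andbT; split=> //.
by rewrite sub1set edges_set2 // wS.
Qed.

Variable (R : comNzRingType).
Local Notation mu := (matching_poly R e).

(** Summing over all matchings at once, instead of sizes, makes the recurrence a
plain splitting of the index set; the exponent is an honest difference by
[card_matching]. *)
Lemma matching_polyE S :
  mu S = \sum_(M | is_matching S M) (-1) ^+ #|M| *: 'X^(#|S| - #|M|.*2).
Proof.
have ltM M : is_matching S M -> (#|M| < (#|S|./2).+1)%N.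
  by move/card_matching => h; rewrite ltnS -(half_double #|M|) half_leq.
rewrite (partition_big (fun M => inord #|M| : 'I_(#|S|./2).+1) predT) //=.
apply: eq_bigr => r _; rewrite mulr_natr.
rewrite [RHS](eq_big (mem (matchings e S r)) (fun _ => (-1) ^+ r *: 'X^(#|S| - r.*2))).
- by rewrite sumr_const scalerMnl.
- move=> M; rewrite !inE andbCA; apply/andP/andP => -[].
    by move=> hM /eqP <-; rewrite inordK ?ltM // eqxx.
  move=> /eqP eM hM; split=> //; apply/eqP/val_inj; rewrite /= inordK //.
  by rewrite eM.
- by move=> M /andP[/ltM hM /eqP <-]; rewrite inordK.
Qed.

(** Matchings avoiding u give the first term; the others are sorted by the partner
w of u, and removing the edge uw costs one sign and two vertices. *)
Lemma matching_poly_rec S u : u \in S ->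
  mu S = 'X * mu (S :\ u) - \sum_(w in S | e u w) mu (S :\ u :\ w).
Proof.
move=> uS; rewrite {1}matching_polyE (bigID (fun M => u \notin cover M)) /=.
congr (_ + _).
  rewrite matching_polyE mulr_sumr; apply: eq_big => [M|M].
    by rewrite is_matchingD1.
  rewrite -is_matchingD1 => /card_matching hM.
  rewrite (cardsD1 u) uS /= addSn add0n subSn // (exprS 'X).
  by rewrite -scalerAr.
pose wit M := odflt u [pick w | [set u; w] \in M].
have witP M : is_matching S M -> u \in cover M ->
    [/\ [set u; wit M] \in M, wit M \in S & e u (wit M)].
  move=> /andP[/subsetP sM tM] /bigcupP[B BM uB].
  have: [set u; wit M] \in M.
    rewrite /wit; case: pickP => [//|/= nM].
    case/edgesP: (sM _ BM) => x [y [_ _ _ eB]].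
    move: uB; rewrite eB !inE => /orP[]/eqP ux; move: BM; rewrite eB -ux.
      by have /= -> := nM y.
    by rewrite setUC; have /= -> := nM x.
  move=> wM; split=> //; by move/sM: (wM); rewrite edges_set2 // => /andP[].
(* [wit M] is the partner of u in M; the default value u is never a partner. *)
rewrite (partition_big wit (fun w => (w \in S) && e u w)) /=; last first.
  by move=> M /andP[hM]; rewrite negbK => /witP[] // _ -> ->.
rewrite -sumrN; apply: eq_bigr => w /andP[wS euw].
have uw : u != w by apply: contraTneq euw => ->; rewrite e_irr.
pose E := [set u; w].
rewrite matching_polyE (reindex_onto (fun M => E |: M) (fun M => M :\ E)) /=; last first.
  move=> M /andP[/andP[hM]]; rewrite negbK => /(witP _ hM)[wM _ _] /eqP ew.
  by rewrite setD1K // /E -ew.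
rewrite -sumrN; apply: eq_big => [M|M hM]; last first.
  have nEM : E \notin M.
    by case/andP: hM => _ /eqP <-; rewrite !inE eqxx.
  rewrite cardsU1 nEM add1n exprS mulN1r scaleNr; congr (- (_ *: 'X^ _)).
  by rewrite (cardsD1 u S) uS (cardsD1 w (S :\ u)) !inE eq_sym uw wS doubleS.
rewrite -(is_matchingU1 M uS wS euw) -/E negbK.
apply/idP/andP => [|[hM nEM]].
  move=> /andP[/andP[/andP[hM _] _] /eqP <-]; split; last by rewrite !inE eqxx.
  by rewrite setD1K // !inE eqxx.
have EM : E \in E |: M by rewrite setU11.
have uM : u \in cover (E |: M) by apply/bigcupP; exists E => //; rewrite set21.
have [wM _ _] := witP _ hM uM.
rewrite hM uM /= setU1K // eqxx andbT.
apply/eqP/esym/eqP; rewrite eq_sym.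
have: [set u; wit (E |: M)] = E.
  apply/eqP; apply: contraTT hM => nE; rewrite /is_matching negb_and.
  apply/orP; right; apply/negP=> /trivIsetP/(_ _ _ wM EM nE) dE.
  by have := disjointFr dE (set21 _ _); rewrite set21.
move/setP/(_ w); rewrite set22 !inE eq_sym (negPf uw) /=.
by rewrite eq_sym => ->.
Qed.

Lemma is_matching0 S : is_matching S set0.
Proof. by rewrite /is_matching sub0set; apply/trivIsetP => A B; rewrite inE. Qed.

(** The empty matching alone contributes to the coefficient of degree |S|. *)
Lemma matching_poly_neq0 S : mu S != 0.
Proof.
suff: (mu S)`_#|S| != 0 by apply: contraNneq => ->; rewrite coef0.
rewrite matching_polyE coef_sum (bigD1 set0) ?is_matching0 //= big1 => [|M].
  by rewrite cards0 expr0 scale1r subn0 coefXn eqxx addr0 oner_eq0.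
case/andP=> /card_matching hM; rewrite -cards_eq0 => M0.
rewrite coefZ coefXn; case: eqP => [|_]; last by rewrite mulr0.
by move=> h; exfalso; move: hM h M0; rewrite -muln2; lia.
Qed.

Lemma matching_poly0 : mu set0 = 1.
Proof.
rewrite matching_polyE (big_pred1 set0) ?cards0 ?expr0 ?scale1r // => M.
apply/idP/eqP => [/card_matching|->]; last exact: is_matching0.
by rewrite cards0 leqn0 double_eq0 cards_eq0 => /eqP.
Qed.
End Recurrence.

(** * The Heilmann-Lieb identity *)

Section SumsOfSquares.
Variable A : comNzRingType.

Definition sos (p : A) := exists s : seq A, p = \sum_(q <- s) q ^+ 2.

Lemma sosD p q : sos p -> sos q -> sos (p + q).
Proof. by case=> s -> [s' ->]; exists (s ++ s'); rewrite big_cat. Qed.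

Lemma sos_sqr p : sos (p ^+ 2).
Proof. by exists [:: p]; rewrite big_seq1. Qed.

Lemma sos0 : sos 0.
Proof. by exists [::]; rewrite big_nil. Qed.

Lemma sos_sum (I : finType) (P : pred I) (f : I -> A) :
  (forall i, P i -> sos (f i)) -> sos (\sum_(i | P i) f i).
Proof. exact: (big_ind _ sos0 sosD). Qed.
End SumsOfSquares.

Section GenericRecurrence.
Variables (T : finType) (e : rel T).
Hypotheses (e_irr : irreflexive e).
Variables (A : comNzRingType) (x : T -> A) (F : {set T} -> A).

(** The vertex weights x are arbitrary: the matching polynomial is the case where
all of them are 'X, and perturbing one weight yields [mult_triple]. *)
Definition vertex_recurrence := forall (S : {set T}) u, u \in S ->
  F S = x u * F (S :\ u) - \sum_(w in S | e u w) F (S :\ u :\ w).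

Definition wronskian (S : {set T}) u v :=
  F (S :\ u) * F (S :\ v) - F S * F (S :\ u :\ v).

Hypothesis Frec : vertex_recurrence.

(** Expanding both F(S) and F(S \ v) at u cancels the weighted terms.  The rest is
split according to the first edge uw of a path from u to v. *)
Lemma wronskian_rec (S : {set T}) u v : u \in S -> v \in S -> u != v ->
  wronskian S u v = (F (S :\ u :\ v)) ^+ 2 *+ e u v
    + \sum_(w in S | e u w && (w != v)) wronskian (S :\ u) w v.
Proof.
move=> uS vS uv.
have uSv : u \in S :\ v by rewrite !inE uv.
rewrite /wronskian (Frec uS) (Frec uSv) (setD1AC S v u).
have -> : \sum_(w in S :\ v | e u w) F (S :\ u :\ v :\ w)
   = \sum_(w in S | e u w && (w != v)) F (S :\ u :\ v :\ w).
  by apply: eq_bigl => w; rewrite !inE; case: (w == v); rewrite ?andbF ?andbT.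
have -> : \sum_(w in S | e u w) F (S :\ u :\ w)
   = F (S :\ u :\ v) *+ e u v + \sum_(w in S | e u w && (w != v)) F (S :\ u :\ w).
  case: (boolP (e u v)) => euv.
    rewrite (bigD1 v) /=; last by rewrite vS.
    by congr (_ + _); apply: eq_bigl => w; rewrite andbA.
  rewrite mulr0n add0r; apply: eq_bigl => w; case: (eqVneq w v) => [->|_].
    by rewrite (negPf euv) !andbF.
  by rewrite andbT.
rewrite sumrB -mulr_suml -mulr_sumr.
have -> : \sum_(w in S | e u w && (w != v)) F (S :\ u :\ w :\ v)
   = \sum_(w in S | e u w && (w != v)) F (S :\ u :\ v :\ w).
  by apply: eq_bigr => w _; rewrite setD1AC.
case: (e u v); rewrite ?mulr1n ?mulr0n; ring.
Qed.

(** Iterating [wronskian_rec] writes the Wronskian as the sum, over the paths from u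
to v, of the squares of F at the complement of the path.  The path reduced to the
edge uv is kept apart, to bound the multiplicity at S minus u and v. *)
Lemma wronskian_sos (S : {set T}) u v : u \in S -> v \in S -> u != v ->
  sos (wronskian S u v - (F (S :\ u :\ v)) ^+ 2 *+ e u v).
Proof.
elim: {S}_.+1 {-2}S (ltnSn #|S|) u v => // n IH S ltS u v uS vS uv.
rewrite wronskian_rec // addrC addKr; apply: sos_sum => w /and3P[wS euw wv].
have uw : u != w by apply: contraTneq euw => ->; rewrite e_irr.
rewrite -[wronskian _ _ _](subrK ((F (S :\ u :\ w :\ v)) ^+ 2 *+ e w v)).
apply: sosD; last by case: (e w v); [exact: sos_sqr|exact: sos0].
apply: IH => //; rewrite ?inE ?wS ?vS ?andbT //; try by rewrite eq_sym.
by move: ltS; rewrite (cardsD1 u) uS.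
Qed.

Lemma wronskian_is_sos (S : {set T}) u v : u \in S -> v \in S -> u != v ->
  sos (wronskian S u v).
Proof.
move=> uS vS uv; rewrite -[wronskian _ _ _](subrK (F (S :\ u :\ v) ^+ 2 *+ e u v)).
apply: sosD; first exact: wronskian_sos.
by case: (e u v); [exact: sos_sqr|exact: sos0].
Qed.
End GenericRecurrence.

Section Matching.
Variables (T : finType) (e : rel T).
Hypotheses (e_sym : symmetric e) (e_irr : irreflexive e).
Variable R : comNzRingType.
Local Notation mu := (matching_poly R e).
Implicit Types (S : {set T}) (u v w d : T).

Lemma mu_rec : vertex_recurrence e (fun _ => 'X) mu.
Proof. by move=> S u uS; apply: matching_poly_rec. Qed.

(** The effect on mu of raising the weight of the single vertex d from 'X to 'X + 1. *)
Definition shifted_mu d S : {poly R} := mu S + mu (S :\ d) *+ (d \in S).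

Lemma shifted_mu_rec d :
  vertex_recurrence e (fun u => 'X + (u == d)%:R) (shifted_mu d).
Proof.
move=> S u uS; rewrite /shifted_mu.
case: (eqVneq u d) => [<-|ud].
  rewrite uS !inE eqxx mulr0n addr0 /= (mu_rec uS) !mulr1n.
  under [in RHS]eq_bigr => w _ do rewrite !inE eqxx andbF mulr0n addr0.
  ring.
rewrite !inE (eq_sym d) ud /= addr0.
case: (boolP (d \in S)) => dS; last first.
  rewrite !mulr0n !addr0.
  under [in RHS]eq_bigr => w _ do rewrite !inE (negPf dS) !andbF mulr0n addr0.
  exact: mu_rec.
have uSd : u \in S :\ d by rewrite !inE ud.
rewrite (mu_rec uS) (mu_rec uSd) !mulr1n (setD1AC S d u).
rewrite big_split /=.
have -> : \sum_(w in S :\ d | e u w) mu (S :\ u :\ d :\ w)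
  = \sum_(w in S | e u w) mu (S :\ u :\ w :\ d) *+ (d \in S :\ u :\ w).
  rewrite [RHS](bigID (fun w => w != d)) /= [X in _ + X]big1 ?addr0.
    apply: eq_big => [w|w /andP[]]; first by rewrite !inE [RHS]andbC andbA.
    by rewrite !inE => /andP[wd _] _; rewrite eq_sym wd eq_sym ud dS setD1AC.
  by move=> w /andP[_]; rewrite negbK => /eqP->; rewrite !inE eqxx.
ring.
Qed.

(** Both sides satisfy the same recurrence at any vertex u, once the double sum over
v and the neighbours w of u is exchanged. *)
Lemma deriv_mu S : (mu S)^`() = \sum_(v in S) mu (S :\ v).
Proof.
elim: {S}_.+1 {-2}S (ltnSn #|S|) => // n IH S ltS.
have [->|[u uS]] := set_0Vmem S.
  by rewrite matching_poly0 // derivC big_set0.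
have ltSu : (#|S :\ u| < n)%N by move: ltS; rewrite (cardsD1 u) uS.
have ltSuw w : w \in S :\ u -> (#|S :\ u :\ w| < n)%N.
  move=> wS; apply: leq_trans ltSu; rewrite ltnS; apply: subset_leq_card.
  exact: subD1set.
rewrite {1}(mu_rec uS) derivB derivM derivX mul1r IH // [X in _ - X]raddf_sum /=.
rewrite [RHS](bigD1 u) //= -addrA; congr (_ + _).
rewrite [X in _ - X](eq_bigr (fun w => \sum_(v in S :\ u :\ w) mu (S :\ u :\ w :\ v)));
  last first.
  move=> w /andP[wS euw]; apply/IH/ltSuw; rewrite !inE wS andbT.
  by apply: contraTneq euw => ->; rewrite e_irr.
have -> : \sum_(v in S | v != u) mu (S :\ v)
  = \sum_(v in S :\ u) ('X * mu (S :\ u :\ v)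
     - \sum_(w in S :\ v | e u w) mu (S :\ u :\ v :\ w)).
  apply: eq_big => [v|v /andP[vS vu]]; first by rewrite !inE andbC.
  by rewrite (@mu_rec _ u) ?(setD1AC S v u) // !inE eq_sym vu.
rewrite sumrB mulr_sumr; congr (_ - _).
rewrite [RHS](exchange_big_dep (fun w => (w \in S) && e u w)) /=; last first.
  by move=> v w _; rewrite !inE => /andP[/andP[_ ->] ->].
apply: eq_bigr => w /andP[wS euw]; apply: eq_big => [v|v _]; last by rewrite setD1AC.
rewrite !inE wS euw !andbT (eq_sym v w) /=.
by rewrite andbC -andbA.
Qed.

(** The diagonal case of the Heilmann-Lieb identity: the right-hand side sums squares
over all paths that start at u, the trivial path giving the first term. *)
Lemma deriv_wronskian S u : u \in S ->
  (mu S)^`() * mu (S :\ u) - mu S * (mu (S :\ u))^`() =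
  mu (S :\ u) ^+ 2 + \sum_(v in S :\ u) wronskian mu S u v.
Proof.
move=> uS; rewrite !deriv_mu (bigD1 u) //=.
rewrite /wronskian sumrB -mulr_sumr -mulr_sumr.
have -> : \sum_(i in S | i != u) mu (S :\ i) = \sum_(v in S :\ u) mu (S :\ v).
  by apply: eq_bigl => v; rewrite !inE andbC.
ring.
Qed.
End Matching.

Section SosDivisibility.
Variables (R : realFieldType) (theta : R).
Local Notation t := ('X - theta%:P).

Lemma sos_root (s : seq {poly R}) :
  t %| \sum_(q <- s) q ^+ 2 -> {in s, forall q, t %| q}.
Proof.
rewrite dvdp_XsubCl rootE horner_sum psumr_eq0 => [/allP /= h q /h|q _].
  by rewrite dvdp_XsubCl rootE horner_exp sqrf_eq0.
by rewrite horner_exp sqr_ge0.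
Qed.

(** After division by the common power of 'X - theta, a sum of squares that vanishes
at theta has all its terms vanishing there. *)
Lemma sos_dvd k (s : seq {poly R}) :
  t ^+ k.*2.+1 %| \sum_(q <- s) q ^+ 2 -> {in s, forall q, t ^+ k.+1 %| q}.
Proof.
have t0 : t != 0 by rewrite polyXsubC_eq0.
elim: k s => [|k IH] s h; first by rewrite expr1 in h *; apply: sos_root.
have ht : t %| \sum_(q <- s) q ^+ 2.
  by apply: dvdp_trans h; rewrite exprS dvdp_mulIl.
have hs := sos_root ht.
have es q : q \in s -> q = t * (q %/ t) by move=> /hs hq; rewrite mulrC divpK.
move=> q qs; rewrite (es q qs) exprS dvdp_mul2l //.
apply: (IH [seq q %/ t | q <- s]); last exact: map_f.
move: h; rewrite doubleS 2!exprS mulrA big_map -expr2.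
rewrite (eq_big_seq (fun q => t ^+ 2 * (q %/ t) ^+ 2)) => [|r rs].
  by rewrite -mulr_sumr dvdp_mul2l // expf_neq0.
by rewrite {1}(es r rs) exprMn.
Qed.

Lemma sos_parity k (p : {poly R}) : sos p ->
  t ^+ k.*2.+1 %| p -> t ^+ k.+1.*2 %| p.
Proof.
case=> s -> /sos_dvd hs; rewrite big_seq.
apply: (big_ind (fun r => t ^+ k.+1.*2 %| r)) => [|? ?|q /hs hq].
- exact: dvdp0.
- exact: dvdp_add.
by rewrite -muln2 exprM; apply: dvdp_exp2r.
Qed.

Lemma sos_parity_add k (p q : {poly R}) : sos p ->
  t ^+ k.*2.+1 %| p + q ^+ 2 -> t ^+ k.+1 %| q.
Proof.
case=> s -> h; apply: (@sos_dvd _ (q :: s)); last exact: mem_head.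
by rewrite big_cons (addrC (q ^+ 2)).
Qed.
End SosDivisibility.

(** * Multiplicities under vertex deletion *)

Section Multiplicity.
Variables (R : realType) (theta : R) (T : finType) (e : rel T).
Hypotheses (e_sym : symmetric e) (e_irr : irreflexive e).
Implicit Types (S : {set T}) (u v w d : T).
Local Notation mu := (matching_poly R e).
Local Notation m := (mult theta e).
Local Notation t := ('X - theta%:P).

Lemma dvd_mu k S : (t ^+ k %| mu S) = (k <= m S)%N.
Proof. by rewrite -mup_geq // matching_poly_neq0. Qed.

Lemma dvd_muM k S1 S2 : (t ^+ k %| mu S1 * mu S2) = (k <= m S1 + m S2)%N.
Proof.
by rewrite -mup_geq ?mupM ?mulf_neq0 // matching_poly_neq0.
Qed.

Lemma dvdp_deriv_exp k (p : {poly R}) : t ^+ k.+1 %| p -> t ^+ k %| p^`().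
Proof.
case/dvdpP=> q ->; rewrite derivM deriv_exp derivXsubC mul1r; apply: dvdp_add.
  by apply/dvdp_mull/dvdp_exp2l.
by rewrite -mulr_natr; apply/dvdp_mull/dvdp_mulr.
Qed.

Lemma dvd_wronskian n S u v : (n <= m (S :\ u) + m (S :\ v))%N ->
  (n <= m S + m (S :\ u :\ v))%N -> t ^+ n %| wronskian mu S u v.
Proof. by move=> h1 h2; apply: dvdp_sub; rewrite dvd_muM. Qed.

(** The two products whose difference is the Wronskian cannot have different
multiplicities when the smaller one is odd, since theta has even multiplicity in
the Wronskian. *)
Lemma mult_parity k S u v : u \in S -> v \in S -> u != v ->
  (k + k < m (S :\ u) + m (S :\ v))%N -> (k + k < m S + m (S :\ u :\ v))%N ->
  ((k + k).+1 < m (S :\ u) + m (S :\ v))%N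
  = ((k + k).+1 < m S + m (S :\ u :\ v))%N.
Proof.
move=> uS vS uv h1 h2; have := dvd_wronskian h1 h2.
rewrite addnn => /sos_parity.
have /[swap]/[apply] : sos (wronskian mu S u v).
  by apply: (wronskian_is_sos e_irr (mu_rec e_sym e_irr R)).
rewrite doubleS => /dvdp_add_eq.
by rewrite dvdpNr !dvd_muM.
Qed.

(** For adjacent u and v the square of mu(S \ u \ v) is one of the squares summing
to the Wronskian, so it absorbs the multiplicity of the whole sum. *)
Lemma mult_edge k S u v : u \in S -> v \in S -> e u v ->
  (k + k < m (S :\ u) + m (S :\ v))%N -> (k + k < m S + m (S :\ u :\ v))%N ->
  (k < m (S :\ u :\ v))%N.
Proof.
move=> uS vS euv; rewrite addnn => h1 h2; have := dvd_wronskian h1 h2.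
have uv : u != v by apply: contraTneq euv => ->; rewrite e_irr.
have := wronskian_sos e_irr (mu_rec e_sym e_irr R) uS vS uv.
rewrite euv mulr1n => /sos_parity_add h h3.
by rewrite -dvd_mu; apply: h; rewrite subrK.
Qed.

(** Interlacing, first half: the square of mu(S \ u) is one of the squares in
[deriv_wronskian], whose left-hand side has multiplicity at least
m(S) + m(S \ u) - 1. *)
Lemma mult_del_ge S u : u \in S -> (m S <= (m (S :\ u)).+1)%N.
Proof.
move=> uS; rewrite leqNgt; apply/negP => lt.
set l := m (S :\ u) in lt *.
suff: t ^+ l.+1 %| mu (S :\ u) by rewrite dvd_mu ltnn.
have [s es] : sos (\sum_(v in S :\ u) wronskian mu S u v).
  apply: sos_sum => v; rewrite !inE => /andP[vu vS].
  by apply: (wronskian_is_sos e_irr (mu_rec e_sym e_irr R)); rewrite // eq_sym.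
apply: (@sos_parity_add _ _ _ (\sum_(v in S :\ u) wronskian mu S u v)); first by exists s.
rewrite [X in _ %| X]addrC -deriv_wronskian //.
have tl : t ^+ l %| mu (S :\ u) by rewrite dvd_mu.
have tS : t ^+ l.+2 %| mu S by rewrite dvd_mu.
apply: dvdp_sub.
  have -> : l.*2.+1 = (l.+1 + l)%N by rewrite -addnn addSn.
  by rewrite exprD dvdp_mul // dvdp_deriv_exp.
case el : l tl => [|l'] tl.
  by apply: dvdp_mulr; apply: dvdp_trans tS; rewrite dvdp_exp2l.
have -> : l'.+1.*2.+1 = (l'.+3 + l')%N by rewrite -addnn; lia.
by rewrite exprD -el dvdp_mul // dvdp_deriv_exp.
Qed.

(** Interlacing, second half: by the first half, every term of the recurrence at u
has multiplicity at least m(S \ u) - 1. *)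
Lemma mult_del_le S u : u \in S -> (m (S :\ u) <= (m S).+1)%N.
Proof.
move=> uS; case el: (m (S :\ u)) => [//|l].
rewrite ltnS -dvd_mu (mu_rec e_sym e_irr R uS); apply: dvdp_sub.
  by apply: dvdp_mull; rewrite dvd_mu el.
apply: (big_ind (fun p => t ^+ l %| p)) => [|? ?|w /andP[wS euw]].
- exact: dvdp0.
- exact: dvdp_add.
have uw : u != w by apply: contraTneq euw => ->; rewrite e_irr.
have := @mult_del_ge (S :\ u) w; rewrite !inE eq_sym uw => /(_ wS).
by rewrite dvd_mu el ltnS.
Qed.

(** Differentiation lowers the multiplicity by exactly one, and the derivative is the
sum of the mu(S \ u), so one of these must have smaller multiplicity. *)
Lemma exists_essential S : (0 < m S)%N ->
  exists2 u, u \in S & (m (S :\ u)).+1 = m S.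
Proof.
move=> mS; have [/exists_inP[u uS /eqP eu]|/exists_inPn nS] :=
  boolP [exists u in S, (m (S :\ u)).+1 == m S]; first by exists u.
suff: t ^+ (m S).+1 %| mu S by rewrite dvd_mu ltnn.
have: t ^+ (m S) %| (mu S)^`().
  rewrite (deriv_mu e_sym e_irr).
  apply: (big_ind (fun p => t ^+ (m S) %| p)) => [|? ?|u uS].
  - exact: dvdp0.
  - exact: dvdp_add.
  rewrite dvd_mu; have := mult_del_ge uS; rewrite leq_eqVlt ltnS.
  by case/orP=> // /eqP ee; have := nS _ uS; rewrite ee eqxx.
have: t ^+ (m S) %| mu S by rewrite dvd_mu.
case: (m S) mS => // k _ /dvdpP[q ->].
rewrite derivM dvdp_addr ?dvdp_mulIr // deriv_exp derivXsubC mul1r /=.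
have t0 : t != 0 by rewrite polyXsubC_eq0.
rewrite mulrnAr -scaler_nat dvdpZr ?pnatr_eq0 // exprS.
rewrite dvdp_mul2r ?expf_neq0 // => tq.
by rewrite -exprS [t ^+ k.+2]exprS dvdp_mul2r ?mulf_neq0 ?expf_neq0.
Qed.

(** If one of the eight products in the Wronskian of [shifted_mu] had odd
multiplicity, smaller than that of all the others, then so would the Wronskian.
The last hypothesis is weaker by one, because parity in S \ d improves it. *)
Lemma mult_triple k S u v d : u \in S -> v \in S -> d \in S ->
    u != v -> u != d -> v != d ->
    (m (S :\ d) + m (S :\ u :\ v))%N = (k + k).+1 ->
    ((k + k).+1 < m (S :\ u) + m (S :\ v :\ d))%N ->
    ((k + k).+1 < m (S :\ v) + m (S :\ u :\ d))%N ->
    ((k + k).+1 < m S + m (S :\ u :\ v :\ d))%N ->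
    ((k + k).+1 < m (S :\ u) + m (S :\ v))%N ->
    ((k + k).+1 < m S + m (S :\ u :\ v))%N ->
    ((k + k).+1 < m (S :\ u :\ d) + m (S :\ v :\ d))%N ->
    (k + k < m (S :\ d) + m (S :\ u :\ v :\ d))%N ->
  False.
Proof.
move=> uS vS dS uv ud vd en h1 h2 h3 h4 h5 h6 h7.
have {}h7 : ((k + k).+1 < m (S :\ d) + m (S :\ u :\ v :\ d))%N.
  have := @mult_parity k (S :\ d) u v.
  rewrite (setD1AC S d u) (setD1AC S d v) (setD1AC (S :\ u) d v).
  rewrite !inE ud vd uS vS => /(_ isT isT uv).
  by move=> /(_ (ltnW h6) h7); rewrite h6 => <-.
have eW : wronskian (shifted_mu e R d) S u v =
  (mu (S :\ u) * mu (S :\ v) - mu S * mu (S :\ u :\ v))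
  + (mu (S :\ u) * mu (S :\ v :\ d) + mu (S :\ v) * mu (S :\ u :\ d)
     - mu S * mu (S :\ u :\ v :\ d))
  + (mu (S :\ u :\ d) * mu (S :\ v :\ d) - mu (S :\ d) * mu (S :\ u :\ v :\ d))
  - mu (S :\ d) * mu (S :\ u :\ v).
  rewrite /wronskian /shifted_mu !inE (eq_sym d u) (eq_sym d v) ud vd dS /=.
  rewrite !mulr1n; ring.
have dW : t ^+ k.+1.*2 %| wronskian (shifted_mu e R d) S u v
            + mu (S :\ d) * mu (S :\ u :\ v).
  rewrite eW subrK doubleS -addnn.
  by do ?[apply: dvdp_sub|apply: dvdp_add]; rewrite dvd_muM.
have dW' : t ^+ k.*2.+1 %| wronskian (shifted_mu e R d) S u v.
  rewrite -(dvdp_addl (n := mu (S :\ d) * mu (S :\ u :\ v))).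
    by apply: dvdp_trans dW; rewrite dvdp_exp2l.
  by rewrite dvd_muM en addnn.
suff: t ^+ k.+1.*2 %| mu (S :\ d) * mu (S :\ u :\ v).
  by rewrite dvd_muM en doubleS addnn ltnn.
rewrite -(dvdp_addr (m := wronskian (shifted_mu e R d) S u v)) //.
apply: sos_parity dW'.
exact: (wronskian_is_sos e_irr (shifted_mu_rec e_sym e_irr R d)).
Qed.

End Multiplicity.

Arguments mult_edge {R} theta {T e} e_sym e_irr k S u v.
Arguments mult_parity {R} theta {T e} e_sym e_irr k S u v.
Arguments mult_triple {R} theta {T e} e_sym e_irr k S u v d.

(** * Special vertices, stability and Gallai's lemma *)

(** Arithmetic on multiplicities.  They are first replaced by variables: deciding
whether two of them are convertible would otherwise unfold the polynomials. *)
Ltac mult_lia := repeat match goal with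
  | H : is_true (~~ _) |- _ => clear H
  | H : is_true (_ \in _) |- _ => clear H
  end;
  repeat match goal with
  | H : context [mult ?th ?e ?S] |- _ =>
      let x := fresh "x" in set (x := mult th e S) in *; clearbody x
  | |- context [mult ?th ?e ?S] =>
      let x := fresh "x" in set (x := mult th e S) in *; clearbody x
  end; lia.

Section GallaiEdmonds.
Variables (R : realType) (theta : R) (T : finType) (e : rel T).
Hypotheses (e_sym : symmetric e) (e_irr : irreflexive e).
Implicit Types (S C D : {set T}) (u v w d : T).
Local Notation m := (mult theta e).
Local Notation mult_del_ge := (@mult_del_ge R theta T e e_sym e_irr _ _).
Local Notation mult_del_le := (@mult_del_le R theta T e e_sym e_irr _ _).
Local Notation mult_edge := (mult_edge theta e_sym e_irr).
Local Notation mult_parity := (mult_parity theta e_sym e_irr).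
Local Notation mult_triple := (mult_triple theta e_sym e_irr).

Lemma adjacent_neq u v : e u v -> u != v.
Proof. by apply: contraTneq => ->; rewrite e_irr. Qed.

Lemma nonessential_ge S u : u \in S -> ~~ essential theta e S u ->
  (m S <= m (S :\ u))%N.
Proof.
move=> uS; rewrite /essential uS /= => h.
by have := mult_del_ge uS; rewrite leq_eqVlt eq_sym (negPf h) ltnS.
Qed.

(** Let v be an essential neighbour of u.  The edge bound forces m(S \ u \ v) to be at
least m(S); if u were neutral, the Wronskian of u and v would then have the odd
multiplicity 2 m(S) - 1. *)
Lemma special_positive S u : special theta e S u -> m (S :\ u) = (m S).+1.
Proof.
case/and3P=> uS nu /exists_inP[v vS /andP[euv /andP[_ /eqP ev]]].
have uv := adjacent_neq euv.
have uSv : u \in S :\ v by rewrite !inE uv.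
have vSu : v \in S :\ u by rewrite !inE eq_sym uv.
have a1 := nonessential_ge uS nu.
have a2 := mult_del_le uS.
have b1 := mult_del_ge uSv; have b2 := mult_del_le uSv.
have c1 := mult_del_ge vSu.
rewrite (setD1AC S v u) in b1 b2.
have E : (m (S :\ v) < m (S :\ u :\ v))%N.
  apply: (mult_edge _ S u v uS vS euv); mult_lia.
have P := mult_parity (m (S :\ v)) S u v uS vS uv ltac:(mult_lia) ltac:(mult_lia).
mult_lia.
Qed.

(** Let d be an essential neighbour of u, and suppose that v becomes essential once u
is deleted.  Write k for m(S \ d), so that m(S) = k + 1.  The edge ud in S \ v
forces m(S \ u \ v \ d) > k.  If v is neutral, parity in S \ d and parity in S \ v
contradict each other.  If v is positive, the product of mu(S \ d) and
mu(S \ u \ v) has multiplicity 2 k + 1, and all the others in the triple u, v, d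
have more. *)
Lemma stability S u v : special theta e S u -> v \in S -> v != u ->
  ~~ essential theta e S v -> (m (S :\ u) <= m (S :\ u :\ v))%N.
Proof.
move=> su vS; rewrite eq_sym => uv nv.
have a := special_positive su.
case/and3P: su => uS nu /exists_inP[d dS /andP[eud ed]].
have vd : v != d by apply: contraNneq nv => ->.
have ud := adjacent_neq eud.
case/andP: ed => _ /eqP ed.
have b1 := nonessential_ge vS nv; have b2 := mult_del_le vS.
rewrite leqNgt; apply/negP => lt.
have vSu : v \in S :\ u by rewrite !inE eq_sym uv.
have dSu : d \in S :\ u by rewrite !inE eq_sym ud.
have dSv : d \in S :\ v by rewrite !inE eq_sym vd.
have uSd : u \in S :\ d by rewrite !inE ud.
have vSd : v \in S :\ d by rewrite !inE vd.
have uSv : u \in S :\ v by rewrite !inE uv.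
have c1 := mult_del_ge vSu.
have d1 := mult_del_ge dSu.
have d2 := mult_del_le uSd.
have dSuv : d \in S :\ u :\ v by rewrite !inE (eq_sym d v) vd (eq_sym d u) ud.
have g1 := mult_del_ge dSuv.
have f1 := mult_del_ge dSv.
have f2 := mult_del_le vSd.
rewrite (setD1AC S d u) in d2; rewrite (setD1AC S d v) in f2.
have vdE : m (S :\ v :\ d) = (m (S :\ v)).-1.
  have := mult_parity (m (S :\ d)) S v d vS dS vd ltac:(mult_lia) ltac:(mult_lia).
  mult_lia.
have uvd : (m (S :\ d) < m (S :\ u :\ v :\ d))%N.
  rewrite (setD1AC S u v); apply: (mult_edge _ _ _ _ uSv dSv eud);
    rewrite ?(setD1AC S v u); mult_lia.
have [bv|bv] : m (S :\ v) = m S \/ m (S :\ v) = (m S).+1 by mult_lia.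
  have := mult_parity (m (S :\ d)) (S :\ d) u v uSd vSd uv.
  rewrite (setD1AC S d u) (setD1AC S d v) (setD1AC (S :\ u) d v).
  move=> /(_ ltac:(mult_lia) ltac:(mult_lia)) P.
  have := mult_parity (m (S :\ d)) (S :\ v) u d uSv dSv ud.
  rewrite (setD1AC S v u) => /(_ ltac:(mult_lia) ltac:(mult_lia)); mult_lia.
apply: (mult_triple (m (S :\ d)) S u v d uS vS dS uv ud vd); mult_lia.
Qed.

(** Call two essential vertices u, v linked when deleting both lowers the multiplicity
by at most one.  Deleting two vertices can lower it by two, but the edge bound
excludes this for adjacent ones. *)
Lemma adjacent_linked S u v : essential theta e S u -> essential theta e S v ->
  e u v -> (m S <= (m (S :\ u :\ v)).+1)%N.
Proof.
move=> /andP[uS /eqP eu] /andP[vS /eqP ev] euv; rewrite leqNgt; apply/negP => lt.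
have vSu : v \in S :\ u by rewrite !inE eq_sym (adjacent_neq euv).
have c1 := mult_del_ge vSu.
have := mult_edge (m (S :\ u :\ v)) S u v uS vS euv ltac:(mult_lia) ltac:(mult_lia).
by rewrite ltnn.
Qed.

(** If u, w were not linked while u, v and v, w are, then in the triple u, w, v the
product of mu(S \ v) and mu(S \ u \ w) alone would have the least multiplicity,
which is odd: the sum of m(S) - 1 and m(S) - 2. *)
Lemma linked_trans S u v w : u != w -> u != v -> v != w ->
  essential theta e S u -> essential theta e S v -> essential theta e S w ->
  (m S <= (m (S :\ u :\ v)).+1)%N -> (m S <= (m (S :\ v :\ w)).+1)%N ->
  (m S <= (m (S :\ u :\ w)).+1)%N.
Proof.
move=> uw uv vw /andP[uS /eqP eu] /andP[vS /eqP ev] /andP[wS /eqP ew] h1 h2.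
rewrite leqNgt; apply/negP => lt.
have wSu : w \in S :\ u by rewrite !inE eq_sym uw.
have wSuv : w \in S :\ u :\ v by rewrite !inE (eq_sym w v) vw (eq_sym w u) uw.
have c1 := mult_del_ge wSu.
have c2 := mult_del_ge wSuv.
rewrite (setD1AC (S :\ u)) in c2; rewrite (setD1AC S v) in h2.
rewrite eq_sym in vw.
apply: (mult_triple (m (S :\ u :\ w)) S u w v uS wS vS uw uv vw); mult_lia.
Qed.

(** By transitivity of linkedness all vertices are linked to u, so nothing is essential
in C \ u, whose multiplicity m(C) - 1 is therefore 0.  Connectedness is expressed
by the absence of a proper nonempty part closed under adjacency. *)
Lemma gallai C u : u \in C ->
  (forall D, u \in D -> (forall x y, x \in D -> y \in C -> e x y -> y \in D) ->
     C \subset D) ->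
  (forall v, v \in C -> essential theta e C v) -> m C = 1%N.
Proof.
move=> uC conn ess.
pose D := [set x | (x \in C) && ((x == u) || (m C <= (m (C :\ u :\ x)).+1)%N)].
have /subsetP CD : C \subset D.
  apply: conn => [|x y]; first by rewrite inE uC eqxx.
  rewrite !inE => /andP[xC hx] yC exy; rewrite yC /=.
  have [//|yu /=] := eqVneq y u; rewrite eq_sym in yu.
  have [xu|xu] := eqVneq x u.
    by apply: adjacent_linked; [exact: ess|exact: ess|rewrite -xu].
  rewrite (negPf xu) /= in hx; rewrite eq_sym in xu.
  apply: (linked_trans yu xu (adjacent_neq exy)); try exact: ess.
    exact: hx.
  by apply: adjacent_linked; [exact: ess|exact: ess|].
have /andP[_ /eqP eu] := ess u uC.
case em : (m C) eu => [//|[//|k]] [eu].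
have [|v] := @exists_essential R theta T e e_sym e_irr (C :\ u); first by rewrite eu.
rewrite !inE eu => /andP[vu vC] [ev].
by have := CD v vC; rewrite !inE vC (negPf vu) /= ev em ltnn.
Qed.
End GallaiEdmonds.

(** * Components *)

Section Components.
Variables (T : finType) (e : rel T).
Hypotheses (e_sym : symmetric e) (e_irr : irreflexive e).
Implicit Types (S C D : {set T}) (u v w d : T) (P : {set {set T}}).

Local Notation adj S := [rel x y | [&& x \in S, y \in S & e x y]].

Lemma adj_connect_sym S : connect_sym (adj S).
Proof. by apply: sym_connect_sym => x y /=; rewrite e_sym andbCA. Qed.

Lemma componentP S C u v : C \in components e S -> u \in C ->
  (v \in C) = (v \in S) && connect (adj S) u v.
Proof.
case/imsetP=> x xS ->; rewrite !inE => /andP[uS xu].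
by rewrite (same_connect (adj_connect_sym S) xu).
Qed.

Lemma component_sub S C : C \in components e S -> C \subset S.
Proof. by case/imsetP=> x xS ->; apply/subsetP => y; rewrite inE => /andP[]. Qed.

Lemma component_closed S C u v :
  C \in components e S -> u \in C -> v \in S -> e u v -> v \in C.
Proof.
move=> cC uC vS euv; rewrite (componentP v cC uC) vS connect1 //=.
by rewrite vS euv (subsetP (component_sub cC)).
Qed.

(** Propagating D along a path inside S, which never leaves C. *)
Lemma component_connected S C u D : C \in components e S -> u \in C -> u \in D ->
  (forall x y, x \in D -> y \in C -> e x y -> y \in D) -> C \subset D.
Proof.
move=> cC uC uD clD; apply/subsetP => v.
rewrite (componentP v cC uC) => /andP[_ /connectP[p]].
elim: p u uC uD => [|y p IH] u uC uD /= => [_ -> //|/andP[/and3P[_ yS euy] py]].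
have yC := component_closed cC uC yS euy.
exact: IH yC (clD _ _ uD yC euy) py.
Qed.

Lemma components_partition S : partition (components e S) S.
Proof.
apply: equivalence_partitionP => x y z _ _ _; split; first exact: connect0.
by move=> xy; apply: (same_connect (adj_connect_sym S) xy).
Qed.

Section Multiplicativity.
Variable R : comNzRingType.
Local Notation mu := (matching_poly R e).

Lemma matching_poly_union S1 S2 : [disjoint S1 & S2] ->
  {in S1 & S2, forall x y, ~~ e x y} -> mu (S1 :|: S2) = mu S1 * mu S2.
Proof.
elim: {S1}_.+1 {-2}S1 (ltnSn #|S1|) => // n IH S1 ltS dS nS.
have [->|[u uS]] := set_0Vmem S1; first by rewrite set0U matching_poly0 // mul1r.
have uS2 : u \notin S2 by rewrite (disjointFr dS uS).
have US w : w \notin S2 -> (S1 :|: S2) :\ w = (S1 :\ w) :|: S2.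
  move=> wS2; rewrite setDUl; congr (_ :|: _); apply/setDidPl.
  by rewrite disjoint_sym disjoints1.
have sub1 : S1 :\ u \subset S1 by exact: subD1set.
have lt1 : (#|S1 :\ u| < n)%N by move: ltS; rewrite (cardsD1 u) uS.
have IHs S' : S' \subset S1 :\ u -> mu (S' :|: S2) = mu S' * mu S2.
  move=> sS; apply: IH; first exact: leq_ltn_trans (subset_leq_card sS) lt1.
    exact: disjointWl (subset_trans sS sub1) dS.
  by move=> x y xS; apply: nS; rewrite (subsetP sub1) // (subsetP sS).
have uU : u \in S1 :|: S2 by rewrite inE uS.
rewrite (mu_rec e_sym e_irr R uU) (mu_rec e_sym e_irr R uS) US // IHs //.
rewrite mulrBl mulrA mulr_suml; congr (_ - _); apply: eq_big => [w|w /andP[wS euw]].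
  rewrite inE; case: (boolP (w \in S2)) => wS2; rewrite ?orbF // orbT.
  by rewrite (negPf (nS u w uS wS2)) !andbF.
have wS2 : w \notin S2 by apply: contraL euw; apply: nS.
rewrite setDUl -IHs ?subD1set //; congr (mu (_ :|: _)); apply/setDidPl.
by rewrite disjoint_sym disjoints1.
Qed.
End Multiplicativity.
End Components.

(** * Barriers *)

Section Barriers.
Variables (R : realType) (theta : R) (T : finType) (e : rel T).
Hypotheses (e_sym : symmetric e) (e_irr : irreflexive e).
Implicit Types (S C D X B : {set T}) (u v w d : T) (P : {set {set T}}).
Local Notation m := (mult theta e).
Local Notation ess := (essential theta e).
Local Notation spe := (special theta e).

Lemma mult_union S1 S2 : [disjoint S1 & S2] ->
  {in S1 & S2, forall x y, ~~ e x y} -> m (S1 :|: S2) = (m S1 + m S2)%N.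
Proof.
move=> d n; rewrite /mult matching_poly_union // mupM // matching_poly_neq0 //.
Qed.

Lemma mult0 : m set0 = 0%N.
Proof. by rewrite /mult matching_poly0 // mupNroot // /root hornerC oner_eq0. Qed.

Lemma mult_cover P : trivIset P ->
  {in P &, forall A B, A != B -> {in A & B, forall x y, ~~ e x y}} ->
  m (cover P) = (\sum_(B in P) m B)%N.
Proof.
elim: {P}_.+1 {-2}P (ltnSn #|P|) => // n IH P ltP tP nP.
have [->|[B BP]] := set_0Vmem P; first by rewrite /cover !big_set0 mult0.
have tP' : trivIset (P :\ B) by apply: trivIsetS tP; exact: subD1set.
rewrite (big_setD1 B) //= -IH //; first last.
- by move=> A A' /setD1P[_ AP] /setD1P[_ AP']; apply: nP.
- by move: ltP; rewrite (cardsD1 B) BP.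
have -> : cover P = B :|: cover (P :\ B) by rewrite /cover (big_setD1 B).
apply: mult_union => [|x y xB /bigcupP[A /setD1P[AB AP]]].
  apply/bigcup_disjointP => A /setD1P[AB AP].
  by move/trivIsetP: tP; apply; rewrite // eq_sym.
by rewrite eq_sym in AB; apply: (nP B A).
Qed.

Lemma mult_components S : m S = (\sum_(C in components e S) m C)%N.
Proof.
have /and3P[/eqP cS tS _] := components_partition e_sym S.
rewrite -{1}cS mult_cover // => A B AS BS AB x y xA yB; apply/negP => exy.
have yS := subsetP (component_sub BS) _ yB.
have yA := component_closed e_sym AS xA yS exy.
move/trivIsetP: tS => /(_ A B AS BS AB) /disjointFr/(_ yA).
by rewrite yB.
Qed.

Lemma component_compl S C : C \in components e S ->
  {in C & S :\: C, forall x y, ~~ e x y}.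
Proof.
move=> cC x y xC /setDP[yS]; apply: contra.
exact: component_closed cC xC yS.
Qed.

Lemma essential_component S C u : C \in components e S -> u \in C ->
  ess C u = ess S u.
Proof.
move=> cC uC; have sC := component_sub cC; have uS := subsetP sC _ uC.
have nC := component_compl cC.
have dC : [disjoint C & S :\: C] by rewrite disjoint_sym disjoints_subset setDE subsetIr.
have eS : S = C :|: (S :\: C) by rewrite -{1}(setID S C) (setIidPr sC).
have eSu : S :\ u = (C :\ u) :|: (S :\: C).
  rewrite {1}eS setDUl; congr (_ :|: _); apply/setDidPl.
  by rewrite disjoint_sym disjoints1 inE uC.
rewrite /essential uC uS /= eSu {2}eS !mult_union //.
- by rewrite -addSn eqn_add2r.
- by apply: disjointWl dC; exact: subD1set.
by move=> x y /setD1P[_ xC]; apply: nC.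
Qed.

Lemma critical_le C : (critical theta e C <= m C)%N.
Proof. by case: (boolP (critical theta e C)) => // /andP[_ /eqP ->]. Qed.

Lemma nb_criticalE S :
  nb_critical theta e S = (\sum_(C in components e S) critical theta e C)%N.
Proof.
rewrite /nb_critical -sum1_card big_mkcond [RHS]big_mkcond; apply: eq_bigr => C _.
by rewrite inE; case: (C \in _); case: (critical _ _ _).
Qed.

Lemma nb_critical_le S : (nb_critical theta e S <= m S)%N.
Proof.
by rewrite nb_criticalE mult_components; apply: leq_sum => C _; exact: critical_le.
Qed.

(** Each component contributes to [nb_critical] at most what it contributes to the
multiplicity, so equality of the totals is equality for each component. *)
Lemma nb_critical_eq S C : nb_critical theta e S = m S ->
  C \in components e S -> m C = critical theta e C.
Proof.
rewrite nb_criticalE mult_components => es cC.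
move: es; rewrite (bigD1 C) //= [RHS](bigD1 C) //=.
have := critical_le C.
have : (\sum_(i in components e S | i != C) critical theta e i
  <= \sum_(i in components e S | i != C) m i)%N.
  by apply: leq_sum => D _; exact: critical_le.
move: (\sum_(i in _ | _) critical _ _ _)%N (\sum_(i in _ | _) m _)%N (m C).
move=> a b c; case: (critical _ _ _) => /=; lia.
Qed.

(** Interlacing at v in S \ u and at u in S \ v leaves only one possible value. *)
Lemma positive_essential S u v : u \in S -> m (S :\ u) = (m S).+1 -> v != u ->
  ess S v -> ess (S :\ u) v.
Proof.
move=> uS eu vu /andP[vS /eqP ev]; rewrite /essential !inE vu vS /=.
have uSv : u \in S :\ v by rewrite !inE eq_sym vu.
have vSu : v \in S :\ u by rewrite !inE vu.
have h1 := mult_del_le theta e_sym e_irr uSv.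
have h2 := mult_del_ge theta e_sym e_irr vSu.
rewrite (setD1AC S v u) in h1; rewrite eu; apply/eqP; mult_lia.
Qed.

Lemma special_essential S u v : spe S u -> v \in S -> v != u ->
  ess (S :\ u) v = ess S v.
Proof.
move=> su vS vu; apply/idP/idP; last first.
  by apply: positive_essential => //; [case/and3P: su|exact: special_positive].
apply: contraLR => nv; have h := stability e_sym e_irr su vS vu nv.
apply/negP => /andP[_ /eqP ev]; by rewrite -ev ltnn in h.
Qed.

(** Deleting a special vertex keeps the essential vertices, hence the other special
ones, and raises the multiplicity by one; this is iterated over B. *)
Lemma special_deletion S B : B \subset special_set theta e S ->
  m (S :\: B) = (m S + #|B|)%N /\ {in S :\: B, ess (S :\: B) =1 ess S}.
Proof.
elim: {B}_.+1 {-2}B (ltnSn #|B|) S => // n IH B ltB S sB.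
have [->|[b bB]] := set_0Vmem B; first by rewrite setD0 cards0 addn0.
have sb : spe S b by have := subsetP sB _ bB; rewrite inE.
have eD : S :\: B = (S :\ b) :\: (B :\ b) by rewrite setDDl setD1K.
have [] := IH (B :\ b) _ (S :\ b).
- by move: ltB; rewrite (cardsD1 b) bB.
- apply/subsetP => a /setD1P[ab aB].
  have := subsetP sB _ aB; rewrite !inE => /and3P[aS na /exists_inP[d dS /andP[ead ed]]].
  have db : d != b by apply: contraTneq ed => ->; case/and3P: sb.
  rewrite /special !inE ab aS special_essential // na /=.
  by apply/exists_inP; exists d; rewrite ?inE ?db // ead special_essential.
rewrite -eD => -> hE; split.
  by rewrite special_positive // (cardsD1 b B) bB addSnnS.
move=> x xSB; rewrite hE //; move: xSB; rewrite eD !inE => /andP[_ /andP[xb xS]].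
exact: special_essential.
Qed.

(** After deletion of the special set no edge joins an essential vertex to a
non-essential one.  So each component is all essential, and critical by [gallai], or without
essential vertices, and of multiplicity 0. *)
Lemma special_nb_critical S :
  nb_critical theta e (S :\: special_set theta e S)
  = (m S + #|special_set theta e S|)%N.
Proof.
have [<- hE] := special_deletion (subxx (special_set theta e S)).
set H := S :\: _ in hE *.
rewrite nb_criticalE mult_components; apply: eq_bigr => C cC.
have sC := component_sub cC.
have eC x : x \in C -> ess C x = ess S x.
  by move=> xC; rewrite (essential_component cC xC) hE // (subsetP sC).
case: (boolP [exists u in C, ess C u]) => [/exists_inP[u uC eu]|/exists_inPn nC].
  have allC x : x \in C -> ess C x.
    move=> xC; rewrite eC //.
    suff /subsetP/(_ x xC) : C \subset [set y | ess S y] by rewrite inE.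
    apply: (component_connected e_sym cC uC); first by rewrite inE -eC.
    move=> y z; rewrite !inE => ey zC eyz.
    have := subsetP sC _ zC; rewrite !inE => /andP[nz zS].
    apply: contraR nz => nz; rewrite /special zS nz; apply/exists_inP; exists y.
      by case/andP: ey.
    by rewrite e_sym eyz.
  have mC : m C = 1%N.
    apply: (gallai e_sym e_irr uC) => // D uD.
    exact: component_connected cC uC uD.
  by rewrite mC /critical mC eqxx andbT; case: forall_inP => // -[].
have mC : m C = 0%N.
  apply/eqP; rewrite -leqn0 leqNgt; apply/negP => /(exists_essential e_sym e_irr)[u uC eu].
  by have := nC u uC; rewrite /essential uC eu eqxx.
by rewrite mC /critical mC andbF.
Qed.

Lemma mult_del_set S X : X \subset S -> (m (S :\: X) <= m S + #|X|)%N.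
Proof.
elim: {X}_.+1 {-2}X (ltnSn #|X|) S => // n IH X ltX S sX.
have [->|[x xX]] := set_0Vmem X; first by rewrite setD0 leq_addr.
have xS := subsetP sX _ xX.
have eD : S :\: X = (S :\ x) :\: (X :\ x) by rewrite setDDl setD1K.
rewrite eD; apply: leq_trans (IH _ _ _ _) _.
- by move: ltX; rewrite (cardsD1 x) xX.
- exact: setSD.
rewrite (cardsD1 x X) xX addnA addn1 leq_add2r.
exact: mult_del_le.
Qed.

(** The multiplicity rises by at most one at each deletion, so a total rise of |X|
leaves no slack on any part of X. *)
Lemma extreme_sub S X B : X \subset S -> m (S :\: X) = (m S + #|X|)%N ->
  B \subset X -> m (S :\: B) = (m S + #|B|)%N.
Proof.
move=> sX eX sB; have sBS := subset_trans sB sX.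
have h1 := mult_del_set sBS.
have := @mult_del_set (S :\: B) (X :\: B) (setSD _ sX).
have -> : (S :\: B) :\: (X :\: B) = S :\: X.
  by rewrite setDDl -{2}(setID X B) (setIidPr sB).
rewrite eX cardsDS //; have := subset_leq_card sB; mult_lia.
Qed.

(** Let x be a positive vertex in X.  By stability x is still positive after deletion
of a, so a is positive in S \ x, where it keeps its essential neighbour. *)
Lemma special_extreme S X a : X \subset S -> m (S :\: X) = (m S + #|X|)%N ->
  spe S a -> a \notin X -> spe (S :\: X) a.
Proof.
elim: {X}_.+1 {-2}X (ltnSn #|X|) S => // n IH X ltX S sX eX sa aX.
have [->|[x xX]] := set_0Vmem X; first by rewrite setD0.
have xS := subsetP sX _ xX.
have eD : S :\: X = (S :\ x) :\: (X :\ x) by rewrite setDDl setD1K.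
have ex : m (S :\ x) = (m S).+1.
  by rewrite (extreme_sub sX eX) ?sub1set // cards1 addn1.
have ax : a != x by apply: contraNneq aX => ->.
have nx : ~~ ess S x by rewrite /essential xS ex /=; apply/eqP; mult_lia.
rewrite eD; apply: IH.
- by move: ltX; rewrite (cardsD1 x) xX.
- exact: setSD.
- by rewrite -eD eX ex (cardsD1 x X) xX addSnnS.
- have ea := special_positive e_sym e_irr sa.
  have xa : x != a by rewrite eq_sym.
  have st := stability e_sym e_irr sa xS xa nx.
  case/and3P: sa => aS na /exists_inP[d dS /andP[ead ed]].
  have dx : d != x by apply: contraNneq nx => <-.
  apply/and3P; split; first by rewrite !inE ax.
    rewrite /essential !inE ax aS /= ex setD1AC; apply/eqP; mult_lia.
  apply/exists_inP; exists d; first by rewrite !inE dx.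
  by rewrite ead positive_essential.
by rewrite !inE negb_and aX orbT.
Qed.

Lemma barrierE S X : barrier theta e S X =
  (X \subset S) && (nb_critical theta e (S :\: X) == (m S + #|X|)%N).
Proof.
by rewrite /barrier eq_sym subr_eq -PoszD eqz_nat.
Qed.

Lemma barrier_extreme S X : barrier theta e S X ->
  m (S :\: X) = (m S + #|X|)%N /\ nb_critical theta e (S :\: X) = m (S :\: X).
Proof.
rewrite barrierE => /andP[sX /eqP eX].
have h1 := nb_critical_le (S :\: X).
have h2 := mult_del_set sX.
split; apply/eqP; rewrite eqn_leq ?h1 ?h2 /= -?eX //.
by rewrite eX.
Qed.

Lemma barrier_positive S X x : barrier theta e S X -> x \in X ->
  m (S :\ x) = (m S).+1.
Proof.
move=> bX xX; have [eX _] := barrier_extreme bX; case/andP: bX => sX _.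
by rewrite (extreme_sub sX eX) ?sub1set // cards1 addn1.
Qed.

Lemma special_barrier S : barrier theta e S (special_set theta e S).
Proof.
rewrite barrierE special_nb_critical eqxx andbT.
by apply/subsetP => x; rewrite inE => /and3P[].
Qed.

(** A special vertex left outside X would share a component of S \ X with an essential
neighbour; that component is critical, which makes the vertex essential. *)
Lemma special_sub_barrier S X : barrier theta e S X ->
  special_set theta e S \subset X.
Proof.
move=> bX; have [eX nX] := barrier_extreme bX; case/andP: bX => sX _.
apply/subsetP => a; rewrite inE => sa; apply: contraT => aX.
have /and3P[aH na /exists_inP[d dH /andP[ead ed]]] := special_extreme sX eX sa aX.
have /and3P[/eqP cH tH _] := components_partition e_sym (S :\: X).
have : d \in cover (components e (S :\: X)) by rewrite cH.
case/bigcupP=> C cC dC.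
have aC : a \in C by apply: (component_closed e_sym cC dC aH); rewrite e_sym.
have edC : ess C d by rewrite (essential_component cC dC).
have := nb_critical_eq nX cC.
case: (boolP (critical theta e C)) => [/andP[/forall_inP aE _] _|_ mC].
  by move: na; rewrite -(essential_component cC aC) aE.
by move: edC; rewrite /essential mC andbF.
Qed.

(** The special set of S \ w is a barrier of S \ w, and w itself raises the
multiplicity by one. *)
Lemma barrierU1 S w : w \in S -> m (S :\ w) = (m S).+1 ->
  barrier theta e S (w |: special_set theta e (S :\ w)).
Proof.
move=> wS ew; set A := special_set _ _ _.
have sA : A \subset S :\ w by apply/subsetP => x; rewrite inE => /and3P[].
have wA : w \notin A by apply/negP => /(subsetP sA); rewrite !inE eqxx.
rewrite barrierE subUset sub1set wS (subset_trans sA (subD1set _ _)) /=.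
by rewrite -setDDl special_nb_critical ew cardsU1 wA addSnnS.
Qed.

(** Otherwise all terms of the recurrence at v would be divisible by a higher power of
'X - theta than mu(S) is. *)
Lemma positive_neighbour S v : v \in S -> m (S :\ v) = (m S).+1 ->
  exists w, [/\ w \in S :\ v, e v w & (m (S :\ v :\ w) <= m S)%N].
Proof.
move=> vS ev.
case: (boolP [exists w in S :\ v, e v w && (m (S :\ v :\ w) <= m S)%N]).
  by case/exists_inP=> w wS /andP[evw h]; exists w.
move/exists_inPn => nw.
suff: ('X - theta%:P) ^+ (m S).+1 %| matching_poly R e S.
  by rewrite dvd_mu // ltnn.
rewrite (mu_rec e_sym e_irr R vS); apply: dvdp_sub.
  by apply: dvdp_mull; rewrite dvd_mu // ev.
apply: (big_ind (fun p => _ %| p)) => [|? ?|w /andP[wS evw]].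
- exact: dvdp0.
- exact: dvdp_add.
rewrite dvd_mu //; have := nw w; rewrite !inE wS evw -ltnNge /=; apply.
by rewrite eq_sym (adjacent_neq e_irr evw).
Qed.
End Barriers.

Theorem theorem1p11 (R : realType) (theta : R) (T : finType) (e : rel T)
    (e_sym : symmetric e) (e_irr : irreflexive e)
    (no_neutral : neutral_set theta e [set: T] = set0) :
  special_set theta e [set: T] =
  \bigcap_(X : {set T} | maxset (barrier theta e [set: T]) X) X.
Proof.
pose m := mult theta e.
have pos u : ~~ essential theta e setT u -> m (setT :\ u) = (m setT).+1.
  move=> nu; have uT : u \in setT by rewrite inE.
  have h1 := nonessential_ge e_sym e_irr uT nu.
  have h2 := mult_del_le theta e_sym e_irr uT.
  have : u \notin neutral_set theta e setT by rewrite no_neutral inE.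
  by rewrite inE /neutral uT /= => /eqP h3; rewrite /m; mult_lia.
apply/eqP; rewrite eqEsubset; apply/andP; split.
  by apply/bigcapsP => X /maxsetp bX; exact: special_sub_barrier.
apply/subsetP => v /bigcapP vX; apply: contraT => nsv.
suff [X [bX vnX]] : exists X, barrier theta e setT X /\
    forall Y, barrier theta e setT Y -> X \subset Y -> v \notin Y.
  have [Y mY XY] := maxset_exists bX.
  by have := vnX Y (maxsetp mY) XY; rewrite vX.
case: (boolP (essential theta e setT v)) => [|nv].
  case/andP=> _ /eqP ev.
  exists (special_set theta e setT); split; first exact: special_barrier.
  move=> Y bY _; apply/negP => /(barrier_positive e_sym e_irr bY).
  mult_lia.
have [w [wT evw mw]] := positive_neighbour e_sym e_irr (in_setT v) (pos _ nv).
have nw : ~~ essential theta e setT w.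
  apply: contra nsv => ew; rewrite inE /special inE nv; apply/exists_inP.
  by exists w; rewrite ?inE ?evw.
exists (w |: special_set theta e (setT :\ w)); split.
  by apply: barrierU1 (pos w nw); rewrite ?inE.
move=> Y bY /subsetP sY; apply/negP => vY.
have wY : w \in Y by rewrite sY ?setU11.
have [eY _] := barrier_extreme e_sym e_irr bY.
have vwY : [set v; w] \subset Y by rewrite subUset !sub1set vY.
have := extreme_sub e_sym e_irr (subsetT Y) eY vwY.
have -> : [set: T] :\: [set v; w] = [set: T] :\ v :\ w by rewrite setDDl.
rewrite cards2 (adjacent_neq e_irr evw); mult_lia.
Qed.
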